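(* Let $G$ be an $n$-vertex graph with shatter function satisfying $\pi_G(z)\le c z^d$ for some $c,d\ge1$. Then $\operatorname{lbp}(G)=O(n^{1-1/(d+1)})$.
   Context: All graphs are finite, simple and undirected. For a set system $\mathcal F\subseteq\mathcal P(X)$ on a finite set $X$, its shatter function $\pi_{\mathcal F}:\{1,\dots,|X|\}\to\mathbb N$ is $\pi_{\mathcal F}(z)=\max_{X'\subseteq X,\,|X'|=z}|\{X'\cap F: F\in\mathcal F\}|$. The shatter function $\pi_G$ of a graph $G$ is the shatter function of the set system $\{N(v):v\in V(G)\}$ on $V(G)$, where $N(v)$ is the (open) neighborhood of $v$. A biclique of $G$ is a (not necessarily induced) complete bipartite subgraph of $G$; a biclique partition of $G$ is a family of bicliques of $G$ whose edge sets partition $E(G)$; $\operatorname{lbp}(G)$ is the least natural number $\ell$ such that $G$ has a biclique partition in which every vertex belongs to at most $\ell$ bicliques. Here $c,d$ are regarded as fixed, so the implied constant may depend on $c$ and $d$ but not on $n$ or $G$. *)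

(* Defs.v *)
From mathcomp Require Import all_boot.
Set Implicit Arguments. Unset Strict Implicit. Unset Printing Implicit Defensive.

Record sgraph := SGraph {
  vertex :> finType;
  adj : rel vertex;
  adj_sym : symmetric adj;
  adj_irrefl : irreflexive adj }.

(* Only the values at 1 <= z <= #|T| are meaningful: an empty maximum is 0. *)
Definition shatter (T : finType) (F : {set {set T}}) (z : nat) : nat :=
  \max_(X : {set T} | #|X| == z) #|[set X :&: A | A : {set T} in F]|.

Definition nbhd (G : sgraph) (v : G) : {set G} := [set w | adj v w].

Definition graph_shatter (G : sgraph) (z : nat) : nat :=
  shatter [set nbhd v | v : G] z.

(* An edge is the unordered pair of its endpoints. *)
Definition edges (G : sgraph) : {set {set G}} :=
  [set [set p.1; p.2] | p : G * G & adj p.1 p.2].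

(* A biclique is given by its two sides. The sides are nonempty, so that a
   biclique has at least one edge; they need not be independent sets of G. *)
Definition biclique_vertices (G : sgraph) (b : {set G} * {set G}) : {set G} :=
  b.1 :|: b.2.

Definition biclique_edges (G : sgraph) (b : {set G} * {set G}) : {set {set G}} :=
  [set [set x; y] | x in b.1, y in b.2].

Definition is_biclique (G : sgraph) (b : {set G} * {set G}) : bool :=
  [&& b.1 != set0, b.2 != set0, [disjoint b.1 & b.2]
    & biclique_edges b \subset edges G].

(* (A, B) and (B, A) describe the same biclique; since bicliques have edges,
   the disjointness clause prevents both from occurring in P. *)
Definition biclique_partition (G : sgraph) (P : {set {set G} * {set G}}) : bool :=
  [&& [forall b in P, is_biclique b],
      [forall b1 in P, forall b2 in P,
         (b1 != b2) ==> [disjoint biclique_edges b1 & biclique_edges b2]]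
    & \bigcup_(b in P) biclique_edges b == edges G].

Definition biclique_load (G : sgraph) (P : {set {set G} * {set G}}) (v : G) : nat :=
  #|[set b in P | v \in biclique_vertices b]|.

Definition has_local_biclique_partition (G : sgraph) (l : nat) : bool :=
  [exists P : {set {set G} * {set G}},
     biclique_partition P && [forall v, biclique_load P v <= l]].

(* The single edges of G form a biclique partition. *)
Lemma local_biclique_partition_exists (G : sgraph) :
  exists l, has_local_biclique_partition G l.
Proof.
pose up (p : G * G) := adj p.1 p.2 && (enum_rank p.1 < enum_rank p.2).
pose f (p : G * G) : {set G} * {set G} := ([set p.1], [set p.2]).
have edE p : biclique_edges (f p) = [set [set p.1; p.2]].
  apply/setP => X; rewrite inE; apply/imset2P/eqP.
    by case=> x y; rewrite !inE => /eqP-> /eqP->.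
  by move=> ->; exists p.1 p.2; rewrite ?inE.
exists #|[set f p | p in up]|; apply/existsP; exists [set f p | p in up].
apply/andP; split; last first.
  by apply/forallP => v; apply/subset_leq_card/subsetP => b; rewrite inE => /andP[].
apply/and3P; split.
- apply/forall_inP => _ /imsetP[p /andP[pa plt] ->]; apply/and4P; split.
  + by apply/set0Pn; exists p.1; rewrite inE.
  + by apply/set0Pn; exists p.2; rewrite inE.
  + by rewrite disjoints1 inE; apply: contraTneq plt => ->; rewrite ltnn.
  + by rewrite edE sub1set; apply/imsetP; exists p; rewrite ?inE.
- apply/forall_inP => _ /imsetP[p /andP[_ plt] ->].
  apply/forall_inP => _ /imsetP[q /andP[_ qlt] ->]; apply/implyP.
  rewrite !edE disjoints1 inE; apply: contraNN => /eqP E.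
  have: p.1 \in [set q.1; q.2] by rewrite -E !inE eqxx.
  have: p.2 \in [set q.1; q.2] by rewrite -E !inE eqxx orbT.
  case: p q plt qlt {E} => [a b] [c d] /=; rewrite !inE => ab cd.
  move=> /orP[]/eqP eb /orP[]/eqP ea; subst a b => //.
  + by rewrite ltnn in ab.
  + by have := ltn_trans ab cd; rewrite ltnn.
  + by rewrite ltnn in ab.
- apply/eqP/setP => X; apply/bigcupP/imsetP.
  + case=> _ /imsetP[p /andP[pa _] ->]; rewrite edE inE => /eqP->.
    by exists p; rewrite ?inE.
  + case=> -[a b]; rewrite inE /= => ab ->.
    case: (ltngtP (enum_rank a) (enum_rank b)) => [lt|lt|/ord_inj/enum_rank_inj E].
    * exists (f (a, b)); last by rewrite edE inE.
      by apply/imsetP; exists (a, b); rewrite // unfold_in /up /= ab.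
    * exists (f (b, a)); last by rewrite edE inE /= setUC.
      by apply/imsetP; exists (b, a); rewrite // unfold_in /up /= adj_sym ab.
    * by rewrite E adj_irrefl in ab.
Qed.

Definition lbp (G : sgraph) : nat := ex_minn (local_biclique_partition_exists G).

(* Main.v *)
Require Import Defs.
From mathcomp Require Import all_boot all_order all_algebra.
From mathcomp Require Import zify ring lra.
From mathcomp Require Import reals sequences exp.
Set Implicit Arguments. Unset Strict Implicit. Unset Printing Implicit Defensive.
Import Order.TTheory GRing.Theory Num.Theory.

(** Order the vertices so that a typical neighbourhood is a union of few
    intervals of the order; cutting these intervals into dyadic ones turns the
    graph into few bicliques per vertex.

    The neighbourhoods form a self-dual set system: [w] lies in [N(x)] iff [x]
    lies in [N(w)].  Hence the shatter function also bounds the number of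
    classes of vertices that a set [X] of vertices tells apart.  If all pairs
    in a set [U] of [m] vertices were separated by at least [n / q]
    neighbourhoods, a greedily chosen set [X] of [O(q log m)] vertices would
    separate all pairs ([separating_sample]), so that
    [m <= c (O(q log m))^d].  Thus [U] contains two vertices separated by
    only [O(n m^(-b))] neighbourhoods, for any fixed [b < 1/d]
    ([close_pair]).

    Removing one vertex of such a pair, ordering the rest by induction and
    reinserting it next to its twin gives an order in which a neighbourhood is
    cut [O(n^(1-b))] times on average ([low_crossing_order]).  By Markov, at
    least half of the vertices are good: they are cut at most twice the
    average.  Each edge with a good end is charged to a good end, the later one
    in the order if both are good.  The vertices charged to a given [w] then
    form few intervals, and the dyadic tree of intervals gives bicliques
    covering all these edges exactly once ([dyadic_bicliques]): each vertex
    lies in [O(log n)] of them as a member of an interval, and in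
    [O(n^(1-b) log n)] as a good end.  The edges that remain lie inside the set
    of bad vertices, which is at most half as large, and recursion costs only a
    geometric sum ([local_arcs]).

    The exponent [1 - 1/(d+1)] exceeds [1 - 1/d]; taking [b] halfway between
    [1/(d+1)] and [1/d] leaves a power of [n] on each side that absorbs the
    logarithms. *)

(** * Boundary crossings of a predicate along a sequence *)

Fixpoint cross (T : Type) (p : pred T) (t : seq T) : nat :=
  if t is x :: t' then
    (if t' is y :: _ then (p x != p y : nat) else 0) + cross p t'
  else 0.

Lemma cross_cons2 (T : Type) (p : pred T) (x y : T) (t : seq T) :
  cross p (x :: y :: t) = (p x != p y) + cross p (y :: t).
Proof. by []. Qed.

Lemma leq_cross_cons (T : Type) (p : pred T) (x : T) (t : seq T) :
  cross p t <= cross p (x :: t).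
Proof. exact: leq_addl. Qed.

Lemma neqb_triangle (a b c : bool) : (a != c) <= (a != b) + (b != c).
Proof. by case: a b c => [] [] []. Qed.

Lemma leq_cross_cat (T : Type) (p : pred T) (s t : seq T) :
  cross p s + cross p t <= cross p (s ++ t).
Proof.
elim: s => [|x s IH] //=; rewrite -addnA leq_add //.
by case: s {IH} => //; case: t.
Qed.

Lemma cross_cat_leq (T : Type) (p : pred T) (s t : seq T) :
  cross p (s ++ t) <= cross p s + cross p t + 1.
Proof.
elim: s => [|x [|y s] IH] /=; first by rewrite leq_addr.
  by case: t {IH} => [|z t] //=; case: (p x == p z); lia.
move: IH => /=; lia.
Qed.

Lemma eq_in_cross (T : eqType) (p q : pred T) (t : seq T) :
  {in t, p =1 q} -> cross p t = cross q t.
Proof.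
elim: t => // x [|y t] IH // E; rewrite !cross_cons2 IH.
  by rewrite !E // !inE eqxx ?orbT.
by move=> z zt; apply: E; rewrite inE zt orbT.
Qed.

Lemma cross_pred0 (T : Type) (t : seq T) : cross pred0 t = 0.
Proof. by elim: t => // x [|y t]. Qed.

(** By the triangle inequality, skipping an element never creates a boundary. *)
Lemma cross_filter (T : Type) (p a : pred T) (t : seq T) :
  cross p (filter a t) <= cross p t.
Proof.
have skip x y s : cross p (x :: s) <= cross p (x :: y :: s).
  case: s => [|z s] //; rewrite !cross_cons2 addnA leq_add2r.
  exact: neqb_triangle.
have keep x s : cross p (x :: filter a s) <= cross p (x :: s).
  elim: s x => // y s IH x; rewrite [filter _ _]/=; case: (a y).
    by rewrite !cross_cons2 leq_add2l.
  exact: leq_trans (IH x) (skip x y s).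
elim: t => // x t IH; rewrite [filter _ _]/=; case: (a x) => //.
exact: leq_trans IH (leq_cross_cons p x t).
Qed.

(** Only the boundary between [x] and [y] is really new: the one after [y]
    replaces the one after [x] and differs from it only if [p] separates [x]
    from [y]. *)
Lemma cross_insert (T : Type) (p : pred T) (x y : T) (s t : seq T) :
  cross p (s ++ x :: y :: t) <= cross p (s ++ x :: t) + 2 * (p x != p y).
Proof.
elim: s => [|z s IH].
  case: t => [|z t]; rewrite !cat0s !cross_cons2 /=; first by lia.
  by case: (p x) (p y) (p z) => [] [] [] /=; lia.
by case: s IH => [|w s] IH; move: IH; rewrite ?cat0s ?cat_cons !cross_cons2; lia.
Qed.

Lemma cross_gt0 (T : Type) (p : pred T) (t : seq T) :
  has p t -> ~~ all p t -> 0 < cross p t.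
Proof.
elim: t => // x [|y t] IH; first by rewrite /= orbF andbT => ->.
rewrite cross_cons2 addn_gt0; case: (eqVneq (p x) (p y)) => //= E.
move: IH; rewrite /= E; case: (p y) => //= IH; exact: IH.
Qed.

(** Restricting [p] to an initial segment adds at most the boundary at its end. *)
Lemma cross_prefix (T : eqType) (p : pred T) (t : seq T) (i : nat) :
  uniq t -> cross (fun u => p u && (index u t < i)) t <= cross p t + 1.
Proof.
move=> ut; rewrite -[X in cross _ X](cat_take_drop i t).
apply: leq_trans (cross_cat_leq _ _ _) _; rewrite leq_add2r.
have lt_take u : u \in take i t -> index u t < i.
  by move=> ui; rewrite -in_take // (mem_take ui).
have ge_drop u : u \in drop i t -> (index u t < i) = false.
  move=> ui; rewrite -in_take ?(mem_drop ui) //; apply/negbTE.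
  move: ut; rewrite -{1}(cat_take_drop i t) cat_uniq => /and3P[_ /hasPn H _].
  exact: H.
rewrite (@eq_in_cross _ _ p (take i t)); last first.
  by move=> u /lt_take ui; rewrite ui andbT.
rewrite (@eq_in_cross _ _ pred0 (drop i t)); last first.
  by move=> u /ge_drop ui; rewrite ui andbF.
rewrite cross_pred0 addn0.
have := leq_cross_cat p (take i t) (drop i t); rewrite cat_take_drop.
exact/leq_trans/leq_addr.
Qed.

(** * Bicliques along a dyadic tree of intervals *)

(** Bicliques are first built as a list of ordered pairs of sides, [arcs L]
    counting how often an ordered pair of vertices runs from left to right.
    Such counts add up under concatenation, which makes exact covering easy to
    track; an edge is covered once when its two orientations total one. *)
Definition arcs (T : finType) (L : seq ({set T} * {set T})) (x y : T) : nat :=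
  count (fun b : {set T} * {set T} => (x \in b.1) && (y \in b.2)) L.

Definition side_load (T : finType) (L : seq ({set T} * {set T})) (v : T) : nat :=
  count (fun b : {set T} * {set T} => v \in b.1) L +
  count (fun b : {set T} * {set T} => v \in b.2) L.

(** The nodes of the tree are the dyadic subintervals of [t].  The biclique at a
    node joins the whole interval to those [w] that are related to all of it
    but were not yet served by a larger interval.  A left vertex lies in one
    interval per level.  For a right vertex [w], the intervals that it cuts are
    the inner nodes of a binary tree whose leaves are the intervals serving [w]
    or unrelated to it; so the latter outnumber the former by at most one, and
    a crossing lies inside at most one interval of each of the [h] levels where
    an interval can be cut. *)
Lemma dyadic_bicliques (T : finType) (h : nat) (r : rel T) (t : seq T) :
  uniq t -> size t <= 2 ^ h ->
  exists L : seq ({set T} * {set T}),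
    [/\ forall u w, arcs L u w = (u \in t) && r u w,
        forall u, count (fun b : {set T} * {set T} => u \in b.1) L <= (u \in t) * h.+1
      & forall w, count (fun b : {set T} * {set T} => w \in b.2) L <=
                  has (r^~ w) t + h * cross (r^~ w) t].
Proof.
pose full (r : rel T) t w := has (r^~ w) t && all (r^~ w) t.
pose root (r : rel T) t : {set T} * {set T} :=
  ([set u in t], [set w | full r t w]).
elim: h r t => [|h IH] r t ut szt.
  exists [:: root r t]; split=> [u w|u|w]; rewrite /arcs /= ?inE ?addn0 ?muln1 //.
    case: t szt {ut} => [|v [|]] //= _; rewrite /full inE /= orbF andbT andbb.
    by case: eqP => // ->.
  by rewrite /full; case: (has (r^~ w) t); case: (all (r^~ w) t).
set k := 2 ^ h; pose t1 := take k t; pose t2 := drop k t.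
have tE : t = t1 ++ t2 by rewrite cat_take_drop.
have [u1 u2] : uniq t1 /\ uniq t2 by rewrite take_uniq // drop_uniq.
have s1 : size t1 <= k by rewrite size_take_min geq_minl.
have s2 : size t2 <= k by rewrite size_drop leq_subLR addnn -mul2n -expnS.
have disj u : u \in t1 -> u \in t2 = false.
  move=> ui; apply/negbTE; move: ut; rewrite tE cat_uniq => /and3P[_ + _].
  by move=> /hasPn H; apply: contraTN ui => /H.
(* Vertices served at the root are dropped from the relation below it. *)
pose r' u w := r u w && ~~ full r t w.
have [L1 [A1 B1 C1]] := IH r' t1 u1 s1.
have [L2 [A2 B2 C2]] := IH r' t2 u2 s2.
exists (root r t :: L1 ++ L2); split=> [u w|u|w].
- rewrite /arcs /= count_cat -/(arcs L1 u w) -/(arcs L2 u w) A1 A2 !inE /r'.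
  have -> : u \in t = (u \in t1) || (u \in t2) by rewrite {1}tE mem_cat.
  case: (boolP (full r t w)) => [fw|nf]; rewrite ?andbF ?andbT /= ?addn0.
    case: (boolP (_ || _)) => //= ut12; move: fw; rewrite /full => /andP[_ /allP].
    by move=> -> //; rewrite tE mem_cat.
  case: (boolP (u \in t1)) => [/disj ->|] /=; last by [].
  by rewrite addn0.
- rewrite /= count_cat !inE; move: (B1 u) (B2 u).
  have -> : u \in t = (u \in t1) || (u \in t2) by rewrite {1}tE mem_cat.
  case: (boolP (u \in t1)) => [/disj ->|] /=; first by lia.
  by case: (u \in t2); lia.
- rewrite /= count_cat inE; move: (C1 w) (C2 w).
  have r'E (s : seq T) : full r t w = false ->
      (has (r'^~ w) s = has (r^~ w) s) * (cross (r'^~ w) s = cross (r^~ w) s).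
    move=> nf; split; first by apply: eq_has => u; rewrite /r' nf andbT.
    by apply: eq_in_cross => u _; rewrite /r' nf andbT.
  case: (boolP (full r t w)) => [fw|nf].
    have r0 (s : seq T) :
        (has (r'^~ w) s = false) * (cross (r'^~ w) s = 0).
      split; first by apply/hasPn => u _; rewrite /r' fw andbF.
      rewrite -(cross_pred0 s); apply: eq_in_cross => u _.
      by rewrite /r' fw andbF.
    rewrite !r0 muln0 !leqn0 => /eqP-> /eqP->.
    by move: fw; rewrite /full => /andP[-> _].
  have nf' := negbTE nf; rewrite !(r'E _ nf').
  have := leq_cross_cat (r^~ w) t1 t2; rewrite -tE => lec.
  have hE : has (r^~ w) t = has (r^~ w) t1 || has (r^~ w) t2.
    by rewrite {1}tE has_cat.
  case: (boolP (has (r^~ w) t)) => hw.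
    have : 0 < cross (r^~ w) t.
      by apply: cross_gt0 => //; move: nf; rewrite /full hw.
    rewrite mulSn.
    have := leq_mul2l h (cross (r^~ w) t1 + cross (r^~ w) t2) (cross (r^~ w) t).
    rewrite lec orbT mulnDr.
    by case: (has _ t1); case: (has _ t2); lia.
  move: hw; rewrite hE negb_or => /andP[/negbTE-> /negbTE->].
  have := leq_mul2l h (cross (r^~ w) t1 + cross (r^~ w) t2) (cross (r^~ w) t).
  rewrite lec orbT mulnDr; lia.
Qed.

(** * From ordered covers to biclique partitions *)

Lemma count_ge2 (T : eqType) (a : pred T) (s : seq T) (x y : T) :
  x \in s -> y \in s -> x != y -> a x -> a y -> 1 < count a s.
Proof.
move=> xs ys nxy ax ay; rewrite -size_filter.
have u2 : uniq [:: x; y] by rewrite /= inE nxy.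
apply: (uniq_leq_size u2) => z; rewrite !inE mem_filter.
by case/orP=> /eqP->; apply/andP.
Qed.

(** Exact covering implies all the other requirements: a vertex on both sides
    would produce a loop, and two bicliques sharing an edge would cover it
    twice.  Pairs with an empty side cover nothing and are dropped. *)
Lemma local_partition_of_arcs (G : sgraph) (L : seq ({set G} * {set G})) (l : nat) :
  (forall x y, arcs L x y + arcs L y x = adj x y) ->
  (forall v, side_load L v <= l) ->
  has_local_biclique_partition G l.
Proof.
move=> hA hl.
pose P := [set b in L | (b.1 != set0) && (b.2 != set0)].
have arc_gt0 b x y : b \in L -> x \in b.1 -> y \in b.2 -> 0 < arcs L x y.
  by move=> bL xb yb; rewrite -has_count; apply/hasP; exists b => //; rewrite xb yb.
have arc_ltn x y : arcs L x y + arcs L y x < 2.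
  by rewrite hA; case: (adj x y).
apply/existsP; exists P; apply/andP; split; last first.
  apply/forallP => v; apply: leq_trans (hl v); rewrite /side_load.
  apply: leq_trans (leq_trans (leq_addr (count (fun b : {set G} * {set G} =>
    (v \in b.1) && (v \in b.2)) L) _) _); last first.
    by rewrite -(count_predUI (fun b : {set G} * {set G} => v \in b.1)).
  rewrite -size_filter /biclique_load; apply: leq_trans (card_size _).
  apply/subset_leq_card/subsetP => b; rewrite !inE mem_filter /biclique_vertices inE.
  by case/andP=> /andP[-> _] ->.
have arc_adj b x y : b \in L -> x \in b.1 -> y \in b.2 -> adj x y.
  by move=> bL xb yb; move: (arc_gt0 b x y bL xb yb) (hA x y); case: (adj x y) => //; lia.
apply/and3P; split.
- apply/forall_inP => b; rewrite inE => /and3P[bL b1 b2]; apply/and4P; split=> //.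
    rewrite -setI_eq0; apply/eqP/setP => x; rewrite !inE; apply/negP => /andP[x1 x2].
    by have := arc_adj b x x bL x1 x2; rewrite adj_irrefl.
  apply/subsetP => _ /imset2P[x y x1 y2 ->]; apply/imsetP; exists (x, y) => //.
  by rewrite inE; apply: arc_adj y2.
- apply/forall_inP => b; rewrite inE => /and3P[bL _ _].
  apply/forall_inP => b'; rewrite inE => /and3P[bL' _ _]; apply/implyP => nbb.
  rewrite -setI_eq0; apply/eqP/setP => X; rewrite !inE; apply/negP => /andP[].
  case/imset2P=> x y xb yb -> /imset2P[x' y' xb' yb' E].
  have nxy (u v : G) : adj u v -> u != v by apply: contraTneq => ->; rewrite adj_irrefl.
  have := nxy _ _ (arc_adj _ _ _ bL xb yb).
  have : x \in [set x'; y'] by rewrite -E !inE eqxx.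
  have : y \in [set x'; y'] by rewrite -E !inE eqxx orbT.
  rewrite !inE => /orP[]/eqP ey /orP[]/eqP ex; subst x y; rewrite ?eqxx // => _.
    have := arc_ltn x' y'.
    by have := arc_gt0 _ _ _ bL xb yb; have := arc_gt0 _ _ _ bL' xb' yb'; lia.
  have := arc_ltn x' y'.
  have : 1 < arcs L x' y'.
    by apply: (count_ge2 bL bL' nbb); apply/andP.
  lia.
- apply/eqP/setP => X; apply/bigcupP/imsetP.
    case=> b; rewrite inE => /and3P[bL _ _] /imset2P[x y x1 y2 ->].
    by exists (x, y) => //; rewrite inE; apply: arc_adj y2.
  have arc_edge x y : 0 < arcs L x y ->
      exists2 b, b \in P & [set x; y] \in biclique_edges b.
    rewrite -has_count => /hasP[b bL /andP[x1 y2]]; exists b.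
      by rewrite inE bL /=; apply/andP; split; apply/set0Pn; [exists x | exists y].
    by apply/imset2P; exists x y.
  case=> -[x y]; rewrite inE /= => axy ->.
  have := hA x y; rewrite axy; case: (posnP (arcs L x y)) => [-> yx|/arc_edge //].
  by rewrite setUC; apply: arc_edge; rewrite -[X in 0 < X]add0n yx.
Qed.

(** * Good vertices and orders with few crossings *)

Lemma arcs_cat (T : finType) (L1 L2 : seq ({set T} * {set T})) (x y : T) :
  arcs (L1 ++ L2) x y = arcs L1 x y + arcs L2 x y.
Proof. exact: count_cat. Qed.

Lemma side_load_cat (T : finType) (L1 L2 : seq ({set T} * {set T})) (v : T) :
  side_load (L1 ++ L2) v = side_load L1 v + side_load L2 v.
Proof. by rewrite /side_load !count_cat addnACA. Qed.

(** Good vertices take charge of all edges they meet, an edge between two good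
    vertices being charged to the later one.  Applying the dyadic tree
    separately to the bad and to the good part of the order keeps the charged
    neighbourhoods almost unions of intervals: filtering creates no crossing,
    and cutting at [w] creates at most one. *)
Lemma arcs_of_order (G : sgraph) (S : {set G}) (t : seq G) (h k : nat)
    (L0 : seq ({set G} * {set G})) (l : nat) :
  uniq t -> t =i S -> #|S| <= 2 ^ h ->
  let bad := [set w in S | k < cross (adj w) t] in
  (forall x y, arcs L0 x y + arcs L0 y x = [&& x \in bad, y \in bad & adj x y]) ->
  (forall v, side_load L0 v <= l) ->
  exists L : seq ({set G} * {set G}),
    (forall x y, arcs L x y + arcs L y x = [&& x \in S, y \in S & adj x y]) /\
    (forall v, side_load L v <= l + (2 * h.+2 + h * (2 * k + 1))).
Proof.
move=> ut tS szS bad hA hl.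
have szt (a : pred G) : size (filter a t) <= 2 ^ h.
  rewrite size_filter (leq_trans (count_size _ _)) // (leq_trans _ szS) //.
  by rewrite -(card_uniqP ut) (eq_card tS).
pose good w := (w \in S) && (w \notin bad).
pose tb := filter (mem bad) t; pose tg := filter good t.
(* Right ends are the vertices in charge; left ends are bad for [rb], good for
   [rg]. *)
pose rb u w := good w && adj w u.
pose rg u w := good w && (adj w u && (index u tg < index w tg)).
have utg : uniq tg by rewrite filter_uniq.
have utb : uniq tb by rewrite filter_uniq.
have bS w : w \in bad -> w \in S by rewrite inE => /andP[].
have tbE u : (u \in tb) = (u \in bad).
  by rewrite mem_filter tS; apply/andP/idP => [[]//|ub]; rewrite bS.
have tgE u : (u \in tg) = good u.
  by rewrite mem_filter tS /good; case: (u \in S); rewrite ?andbF // andbT.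
have [L1 [A1 B1 C1]] := dyadic_bicliques rb utb (szt _).
have [L2 [A2 B2 C2]] := dyadic_bicliques rg utg (szt _).
have cross_good w : good w -> cross (adj w) t <= k.
  by rewrite /good inE => /andP[->]; rewrite /= -leqNgt.
exists (L0 ++ L1 ++ L2); split=> [x y|v].
  rewrite !arcs_cat !A1 !A2 !tbE !tgE /rb /rg.
  have -> : forall a b c d e f : nat, a + (b + c) + (d + (e + f)) =
     (a + d) + (b + c + e + f) by move=> *; lia.
  rewrite hA [adj y x]adj_sym.
  have [axy|] := boolP (adj x y); last by rewrite !andbF.
  have nxy : good x -> good y -> index x tg != index y tg.
    rewrite -!tgE => gx gy; apply/eqP => E; move: axy.
    by rewrite (index_inj x gx gy E) adj_irrefl.
  move: nxy (bS x) (bS y); rewrite /good.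
  case: (x \in bad); case: (y \in bad) => /=;
    case: (x \in S); case: (y \in S) => //=;
    rewrite ?(andbF, andbT, andFb, andTb) //=;
    by [move=> /(_ isT isT); case: ltngtP
       | move=> _ _ /(_ isT) | move=> _ /(_ isT)].
rewrite !side_load_cat leq_add // /side_load.
move: (B1 v) (C1 v) (B2 v) (C2 v); rewrite tbE tgE.
have cL1 : cross (rb^~ v) tb <= k.
  rewrite /rb; case: (boolP (good v)) => gv /=; last by rewrite cross_pred0.
  exact: leq_trans (cross_filter _ _ _) (cross_good _ gv).
have cL2 : cross (rg^~ v) tg <= k + 1.
  rewrite /rg; case: (boolP (good v)) => gv /=; last by rewrite cross_pred0.
  apply: leq_trans (cross_prefix _ _ utg) _; rewrite leq_add2r.
  exact: leq_trans (cross_filter _ _ _) (cross_good _ gv).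
have := leq_mul2l h (cross (rb^~ v) tb) k.
have := leq_mul2l h (cross (rg^~ v) tg) (k + 1).
rewrite cL1 cL2 !orbT.
have := leq_b1 (has (rb^~ v) tb); have := leq_b1 (has (rg^~ v) tg).
rewrite /good; case: (v \in bad); case: (v \in S) => /=; lia.
Qed.

(** [F m] is a potential whose increment from [m - 1] to [m] pays for inserting
    one vertex next to its twin among [m] vertices; the factor 2 is the one
    of [cross_insert]. *)
Lemma order_by_insertion (R : numDomainType) (G : sgraph) (S : {set G}) (F : nat -> R) :
  (0 <= F 1%N)%R ->
  (forall U : {set G}, U \subset S -> (1 < #|U|)%N ->
     exists x y : G, [/\ x \in U, y \in U, x != y &
       ((2 * #|[set w in S | adj w x != adj w y]|)%:R <= F #|U| - F #|U|.-1)%R]) ->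
  S != set0 ->
  exists t : seq G, [/\ uniq t, t =i S &
    ((\sum_(w in S) cross (adj w) t)%:R <= F #|S|)%R].
Proof.
move=> F1 close S0.
suff H m : forall U : {set G}, U \subset S -> #|U| = m.+1 ->
    exists t : seq G, [/\ uniq t, t =i U &
      ((\sum_(w in S) cross (adj w) t)%:R <= F #|U|)%R].
  by apply: (H #|S|.-1) => //; rewrite prednK // card_gt0.
elim: m => [|m IH] U US cU.
  have /cards1P[x Ux] : #|U| == 1%N by rewrite cU.
  exists [:: x]; split=> // [u|]; first by rewrite Ux !inE.
  by rewrite big1 // cU.
have [|x [y [xU yU nxy sep]]] := close U US; first by rewrite cU.
have cUy : #|U :\ y| = m.+1 by have := cardsD1 y U; rewrite yU cU => -[].
have [t [ut tU sumt]] := IH (U :\ y) (subset_trans (subsetDl _ _) US) cUy.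
have xt : x \in t by rewrite tU !inE nxy.
have yt : y \notin t by rewrite tU !inE eqxx.
case/splitPr: {t} xt => s1 s2 in ut tU sumt yt *.
exists (s1 ++ x :: y :: s2); split.
- have perm : perm_eq (s1 ++ x :: y :: s2) (y :: s1 ++ x :: s2).
    by rewrite -cat_rcons perm_catC /= perm_cons perm_catC cat_rcons.
  by rewrite (perm_uniq perm) /= yt.
- move=> u; have := tU u; rewrite !mem_cat !inE.
  by case: (eqVneq u y) => [-> _|_ /= <-] /=; rewrite ?yU ?orbT.
apply: (@le_trans _ _ ((\sum_(w in S) (cross (adj w) (s1 ++ x :: s2) +
                            2 * (adj w x != adj w y)))%:R)%R).
  by rewrite ler_nat; apply: leq_sum => w _; apply: cross_insert.
rewrite big_split /= -big_distrr /= natrD.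
have -> : \sum_(w in S) (adj w x != adj w y) = #|[set w in S | adj w x != adj w y]|.
  by rewrite -sum1dep_card big_mkcondr.
move: sep sumt; rewrite cUy cU /= => sep sumt.
by rewrite -(subrK (F m.+1) (F m.+2)) addrC lerD.
Qed.

(** * Close pairs of vertices *)

(** Averaging over [S], some vertex splits at least a fraction [1/q] of the
    pairs that are not split yet; adding it to [X] multiplies their number by
    at most [1 - 1/q]. *)
Lemma greedy_separation (G : sgraph) (S : {set G}) (D : {set G * G}) (q z : nat) :
  S != set0 ->
  (forall p, p \in D -> #|S| <= q * #|[set w in S | adj w p.1 != adj w p.2]|) ->
  exists X : {set G}, #|X| <= z /\
    #|[set p in D | [forall w in X, adj w p.1 == adj w p.2]]| * q ^ z
      <= #|D| * q.-1 ^ z.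
Proof.
move=> S0 sepD; elim: z => [|z [X [cX IH]]].
  exists set0; rewrite cards0 !muln1; split=> //.
  by apply/subset_leq_card/subsetP => p; rewrite inE => /andP[].
set U := [set p in D | _] in IH.
pose split w := [set p in U | adj w p.1 != adj w p.2].
have [w wS hw] : exists2 w, w \in S & #|U| <= q * #|split w|.
  apply/exists_inP; apply: contraT; rewrite negb_exists_in => /forall_inP none.
  have double_count : \sum_(w in S) #|split w| =
      \sum_(p in U) #|[set w in S | adj w p.1 != adj w p.2]|.
    under eq_bigr do rewrite -sum1dep_card big_mkcondr.
    under [RHS]eq_bigr do rewrite -sum1dep_card big_mkcondr.
    exact: exchange_big.
  have lo : #|U| * #|S| <= q * \sum_(w in S) #|split w|.
    rewrite double_count big_distrr /= -sum_nat_const; apply: leq_sum => p.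
    by rewrite inE => /andP[/sepD].
  have hi : q * \sum_(w in S) #|split w| < #|S| * #|U|.
    rewrite big_distrr /= -sum_nat_const; have /set0Pn[w wS] := S0.
    rewrite (bigD1 w) //= [X in _ < X](bigD1 w) //= -addSn.
    apply: leq_add; first by rewrite ltnNge none.
    by apply: leq_sum => v /andP[vS _]; rewrite ltnW // ltnNge none.
  by move: (leq_ltn_trans lo hi); rewrite mulnC ltnn.
exists (w |: X); split; first by rewrite cardsU1 (leq_trans (leq_add (leq_b1 _) cX)).
have -> : [set p in D | [forall v in w |: X, adj v p.1 == adj v p.2]] = U :\: split w.
  apply/setP => p; rewrite !inE; case: (p \in D); rewrite ?andbF //=.
  apply/forall_inP/andP => [H|[+ /forall_inP H] v].
    split; last by apply/forall_inP => v vX; apply: H; rewrite inE vX orbT.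
    by rewrite negb_and negbK (H w) ?orbT // !inE eqxx.
  rewrite negb_and negbK => /orP[/forall_inP//|Hw].
  by rewrite !inE => /orP[/eqP->|/H].
have sub : split w \subset U by apply/subsetP => p; rewrite inE => /andP[].
rewrite cardsDS // !expnS mulnCA mulnA [X in _ <= X]mulnCA.
apply: leq_trans (_ : q.-1 * #|U| * q ^ z <= _); last by rewrite -mulnA leq_mul2l IH orbT.
rewrite leq_mul2r; apply/orP; right; rewrite mulnBr leq_subLR -[X in X <= _]/(q * _).
move: #|U| #|split w| hw => u s; case: (q) => [|q' hw]; first by rewrite !mul0n.
by rewrite succnK mulSn leq_add2r.
Qed.

(** This is [(1 - 1/q)^q <= 1/2], by the first two terms of the binomial
    expansion. *)
Lemma double_pred_exp (q : nat) : 0 < q -> 2 * q.-1 ^ q <= q ^ q.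
Proof.
case: q => // q _; rewrite succnK.
suff H n : q ^ n.+1 + n.+1 * q ^ n <= q.+1 ^ n.+1.
  by apply: leq_trans (H q); rewrite mul2n -addnn leq_add2l expnS leq_mul2r leqnSn orbT.
elim: n => [|n IH]; first by rewrite !expn1 expn0 muln1 addn1.
rewrite [X in _ <= X]expnS; apply: leq_trans (leq_mul (leqnn _) IH).
by rewrite !expnS; nia.
Qed.

(** After [q * j] greedy steps fewer than one of the at most [#|U|^2] pairs is
    left, so distinct vertices of [U] have distinct traces on [X]. *)
Lemma separating_sample (G : sgraph) (S U : {set G}) (q j : nat) :
  0 < q -> 1 < #|U| -> #|U| ^ 2 < 2 ^ j -> S != set0 ->
  (forall x y, x \in U -> y \in U -> x != y ->
     #|S| <= q * #|[set w in S | adj w x != adj w y]|) ->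
  exists X : {set G}, [/\ 0 < #|X|, #|X| <= q * j &
    #|U| <= #|[set X :&: nbhd v | v : G]|].
Proof.
move=> q0 U1 Uj S0 far.
pose D := [set p : G * G | [&& p.1 \in U, p.2 \in U & p.1 != p.2]].
have cD : #|D| <= #|U| ^ 2.
  rewrite -mulnn -cardsX; apply/subset_leq_card/subsetP => p; rewrite !inE.
  by case/and3P=> -> ->.
have [|X [cX unsep]] := @greedy_separation G S D q (q * j) S0.
  by move=> p; rewrite inE => /and3P[]; apply: far.
set W := [set p in D | _] in unsep.
have W0 : W = set0.
  apply/eqP; rewrite -cards_eq0 -leqn0 -ltnS.
  have qq : 2 ^ j * q.-1 ^ (q * j) <= q ^ (q * j).
    by rewrite !expnM -expnMn leq_exp2r ?double_pred_exp //; case: j Uj {cX unsep}; lia.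
  have qz : 0 < q ^ (q * j) by rewrite expn_gt0 q0.
  have : #|W| * 2 ^ j * q ^ (q * j) <= #|D| * q ^ (q * j).
    apply: leq_trans (leq_mul (leqnn #|D|) qq).
    by rewrite mulnAC mulnCA [X in _ <= X]mulnC leq_mul2r mulnC
      [X in X <= _]mulnC unsep orbT.
  rewrite leq_pmul2r // => WD; have := leq_ltn_trans (leq_trans WD cD) Uj.
  by rewrite -[X in _ < X]mul1n ltn_pmul2r ?expn_gt0.
have inj : {in U &, injective (fun v => X :&: nbhd v)}.
  move=> x y xU yU /setP E; apply/eqP; apply: contraT => nxy.
  have /setP/(_ (x, y)) := W0; rewrite !inE xU yU nxy /= => /negbT/forall_inPn[w wX].
  by have := E w; rewrite !inE wX /= ![adj w _]adj_sym => ->; rewrite eqxx.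
exists X; split=> //; last first.
  rewrite -(card_in_imset inj); apply/subset_leq_card/subsetP => _ /imsetP[v _ ->].
  exact: imset_f.
rewrite lt0n cards_eq0; apply: contraTneq U1 => X0; rewrite -leqNgt.
rewrite -(card_in_imset inj) X0 -(cards1 (set0 : {set G})).
by apply/subset_leq_card/subsetP => _ /imsetP[v _ ->]; rewrite set0I inE.
Qed.

Local Open Scope ring_scope.

(** * Estimates for real powers *)

Lemma powRDp (R : realType) (x r s : R) : 0 < x -> x `^ (r + s) = x `^ r * x `^ s.
Proof. by move=> x0; rewrite powRD // lt0r_neq0 ?implybT. Qed.

Lemma ge1_powR (R : realType) (x r : R) : 1 <= x -> 0 <= r -> 1 <= x `^ r.
Proof. by move=> x1 r0; rewrite -(powRr0 x) ler_powR. Qed.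

Lemma trunc_log_le_powR (R : realType) (e : R) : 0 < e ->
  exists2 E : R, 1 <= E &
    forall n : nat, (0 < n)%N -> (trunc_log 2 n).+1%:R <= E * n%:R `^ e.
Proof.
move=> e0; have l2 : 0 < ln 2 :> R by rewrite ln_gt0 // ltr1n.
have el : 0 < e * ln 2 by rewrite mulr_gt0.
exists ((e * ln 2)^-1 + 1); first by rewrite lerDr invr_ge0 ltW.
move=> n n0; have n1 : 1 <= n%:R :> R by rewrite ler1n.
rewrite mulrDl mul1r -natr1 lerD //; last by rewrite ge1_powR // ltW.
rewrite ler_pdivlMl //.
have lnn : (trunc_log 2 n)%:R * ln 2 <= ln (n%:R : R).
  rewrite mulr_natl -lnXn // ler_ln ?posrE ?exprn_gt0 ?ltr0n // -natrX ler_nat.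
  exact: trunc_logP.
apply: le_trans (_ : e * ln (n%:R : R) <= _).
  by rewrite -mulrA [ln 2 * _]mulrC ler_wpM2l // ltW.
rewrite /powR gt_eqF ?ltr0n //; apply: le_trans (expR_ge1Dx _).
by rewrite lerDr.
Qed.

(** A discrete form of [(x^g)' = g x^(g-1)], with a factor 2 lost because
    [(m - 1)^g] is replaced by [m^g / 2]; it avoids summing [m^(g-1)]. *)
Lemma powR_increment (R : realType) (g : R) (m : nat) :
  0 < g -> g <= 1 -> (1 < m)%N ->
  g / 2 * m%:R `^ (g - 1) <= m%:R `^ g - m.-1%:R `^ g.
Proof.
case: m => [|[|m]] // g0 g1 _; rewrite succnK.
set x : R := m.+2%:R; set y : R := m.+1%:R.
have x0 : 0 < x by rewrite ltr0n.
have y0 : 0 < y by rewrite ltr0n.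
have xy : x = y + 1 by rewrite /x /y -natr1.
have y1 : 1 <= y by rewrite ler1n.
have ratio : 1 + g / x <= (x / y) `^ g.
  rewrite /powR gt_eqF ?divr_gt0 //; apply: le_trans (expR_ge1Dx _).
  rewrite lerD2l ler_pM2l // -[x / y]invrK lnV ?posrE ?invr_gt0 ?divr_gt0 //.
  rewrite invf_div lerNr.
  have -> : y / x = 1 + - x^-1 by rewrite -[y](addrK 1) -xy mulrBl divff ?gt_eqF // mul1r.
  by apply: le_ln1Dx; rewrite ltrN2 invf_lt1 // xy; lra.
have half : x `^ g / 2 <= y `^ g.
  have h1 : (x / 2) `^ g <= y `^ g.
    by apply: ge0_ler_powR; rewrite ?nnegrE; lra.
  apply: le_trans h1; rewrite powRM ?invr_ge0 ?(ltW x0) //.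
  by rewrite ler_wpM2l ?powR_ge0 // ger1_powR //; lra.
have -> : x `^ g = y `^ g * (x / y) `^ g.
  by rewrite -powRM ?divr_ge0 ?ltW // mulrCA divff ?mulr1 ?gt_eqF.
rewrite -[X in _ <= _ - X]mulr1 -mulrBr.
apply: le_trans (_ : x `^ g / 2 * (g / x) <= _).
  rewrite powRDp // powR_inv1 ?(ltW x0) //; rewrite le_eqVlt; apply/orP; left; apply/eqP; ring.
apply: ler_pM half _; rewrite ?divr_ge0 ?powR_ge0 ?(ltW g0) ?(ltW x0) //.
by rewrite lerBrDl.
Qed.

(** Any constant below 1 in place of [3/4] would make the recursion over the bad
    vertices a geometric sum; [3/4] works since [2^(-1/2) < 3/4]. *)
Lemma half_powR (R : realType) (a x : R) : 1 / 2 <= a -> 0 <= x ->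
  (x / 2) `^ a <= 3 / 4 * x `^ a.
Proof.
move=> a2 x0; rewrite powRM ?invr_ge0 // [X in X <= _]mulrC ler_wpM2r ?powR_ge0 //.
apply: le_trans (_ : (2^-1) `^ (1 / 2) <= _).
  by apply: ger_powR => //; lra.
set y := _ `^ _; have y0 : 0 <= y by apply: powR_ge0.
have yy : y * y = 1 / 2.
  rewrite /y -powRDp ?invr_gt0 // (_ : 1 / 2 + 1 / 2 = 1); last by lra.
  by rewrite powRr1 ?invr_ge0 // mul1r.
nra.
Qed.

(** * Assembling the bounds *)

(** If all pairs were far apart, a separating sample would have size
    [O(m^b m^e) = O(m^(1/d))], and the constant [8 E c] makes it so small that
    its at most [c |X|^d <= m / 2] traces cannot distinguish [m] vertices. *)
Lemma close_pair (R : realType) (c d b e E : R) (G : sgraph) (S U : {set G}) :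
  1 <= c -> 1 <= d -> 1 <= E -> 0 <= b -> b + e = 1 / d ->
  (forall n : nat, (0 < n)%N -> (trunc_log 2 n).+1%:R <= E * n%:R `^ e) ->
  (forall z : nat, (1 <= z <= #|G|)%N -> (graph_shatter G z)%:R <= c * z%:R `^ d) ->
  U \subset S -> (1 < #|U|)%N ->
  exists x y : G, [/\ x \in U, y \in U, x != y &
    #|[set w in S | adj w x != adj w y]|%:R <= 8 * E * c * #|S|%:R * #|U|%:R `^ (- b)].
Proof.
move=> c1 d1 E1 b0 be logE shat US U1.
set m := #|U|; set N := #|S|; set C := 8 * E * c.
have C0 : 0 < C by rewrite !mulr_gt0 //; lra.
have m0 : 0 < m%:R :> R by rewrite ltr0n (ltn_trans _ U1).
have m1 : 1 <= m%:R :> R by rewrite ler1n (ltn_trans _ U1).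
have mb1 := ge1_powR m1 b0.
pose sep x y := #|[set w in S | adj w x != adj w y]|.
have sepN x y : (sep x y <= N)%N.
  by apply/subset_leq_card/subsetP => w; rewrite inE => /andP[].
(* When [m] is small, the claimed bound exceeds [N] and any pair will do. *)
have [mC|Cm] := leP (m%:R `^ b) C.
  have /card_gt1P[x [y [xU yU nxy]]] := U1; exists x, y; split=> //.
  rewrite powRN ler_pdivlMr ?(lt_le_trans ltr01 mb1) // mulrC.
  by apply: ler_pM mC _; rewrite ?powR_ge0 // ler_nat sepN.
case: (boolP [exists p : G * G, [&& p.1 \in U, p.2 \in U, p.1 != p.2 &
    (sep p.1 p.2)%:R <= C * N%:R * m%:R `^ (- b)]]) => [/existsP[[x y]]|].
  by case/and4P=> *; exists x, y.
rewrite negb_exists => /forallP none; exfalso.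
pose q := (Num.truncn (m%:R `^ b / C)).+1.
pose j := (2 * (trunc_log 2 m).+1)%N.
have q_gt : m%:R `^ b / C < q%:R by rewrite truncnS_gt.
have q_le : q%:R <= 2 * (m%:R `^ b / C).
  have : 1 <= m%:R `^ b / C by rewrite ler_pdivlMr // mul1r ltW.
  have : (Num.truncn (m%:R `^ b / C))%:R <= m%:R `^ b / C.
    by rewrite truncn_le divr_ge0 ?powR_ge0 ?ltW.
  rewrite /q -natr1; lra.
have j_le : j%:R <= 2 * (E * m%:R `^ e).
  by rewrite /j natrM ler_wpM2l // logE // -(ltr0n R).
have mj : (m ^ 2 < 2 ^ j)%N.
  by rewrite /j mulnC expnM ltn_sqr trunc_log_ltn.
have S0 : S != set0.
  rewrite -card_gt0; apply: leq_trans (subset_leq_card US); exact: ltn_trans U1.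
have [x y xU yU nxy|X [X0 cX mX]] := separating_sample (ltn0Sn _ : (0 < q)%N) U1 mj S0.
  have := none (x, y); rewrite /= xU yU nxy /= -ltNge powRN => lt.
  rewrite -(ler_nat R) natrM -/(sep x y).
  have {}lt : N%:R * C < (sep x y)%:R * m%:R `^ b.
    by move: lt; rewrite ltr_pdivrMr ?(lt_le_trans ltr01) // [C * _]mulrC.
  have := ltW lt; rewrite -ler_pdivlMr // => /le_trans; apply.
  by rewrite -mulrA mulrC ler_wpM2r // ltW.
have XG : (#|X| <= #|G|)%N by apply: max_card.
have mle : m%:R <= c * #|X|%:R `^ d.
  have := shat #|X|; rewrite X0 XG => /(_ isT); apply: le_trans.
  rewrite ler_nat; apply: leq_trans mX _; rewrite /graph_shatter /shatter.
  apply: leq_trans (leq_bigmax_cond _ (eqxx #|X|)).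
  by apply/subset_leq_card/subsetP => _ /imsetP[v _ ->]; apply/imset_f/imset_f.
have Xle : #|X|%:R <= (2 * c)^-1 * m%:R `^ (1 / d).
  apply: le_trans (_ : (q * j)%:R <= _); first by rewrite ler_nat.
  rewrite natrM -be powRDp //.
  apply: le_trans (ler_pM _ _ q_le j_le) _ => //.
  rewrite /C le_eqVlt; apply/orP; left; apply/eqP; field; apply/andP; split; lra.
have : c * #|X|%:R `^ d <= m%:R / 2.
  apply: le_trans (_ : c * ((2 * c)^-1 * m%:R `^ (1 / d)) `^ d <= _).
    rewrite ler_wpM2l ?ge0_ler_powR ?nnegrE //; try lra.
    by rewrite mulr_ge0 ?powR_ge0 // invr_ge0; lra.
  have c2 : 0 < (2 * c)^-1 by rewrite invr_gt0; lra.
  rewrite powRM ?powR_ge0 ?(ltW c2) // -powRrM divfK ?powRr1 ?(ltW m0) //; last lra.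
  apply: le_trans (_ : c * ((2 * c)^-1 * m%:R) <= _).
    rewrite ler_wpM2l ?ler_wpM2r ?(ltW m0) //; first lra.
    by apply: ge1r_powR => //; rewrite c2 invf_le1; lra.
  by rewrite le_eqVlt; apply/orP; left; apply/eqP; field; lra.
lra.
Qed.

(** Recursion on the bad vertices: a round costs at most [A N^a], and the
    recursive call on at most [N / 2] vertices at most
    [4 A (N / 2)^a <= 3 A N^a], for a total of [4 A N^a]. *)
Lemma local_arcs (R : realType) (K E a g e : R) (G : sgraph) :
  0 < K -> 1 <= E -> 0 <= g -> 1 / 2 <= a -> g + e = a ->
  (forall n : nat, (0 < n)%N -> (trunc_log 2 n).+1%:R <= E * n%:R `^ e) ->
  (forall S : {set G}, S != set0 -> exists t : seq G, [/\ uniq t, t =i S &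
     (\sum_(w in S) cross (adj w) t)%:R <= K * #|S|%:R * #|S|%:R `^ g]) ->
  forall S : {set G}, exists L : seq ({set G} * {set G}),
    (forall x y, arcs L x y + arcs L y x = [&& x \in S, y \in S & adj x y])%N /\
    (forall v, (side_load L v)%:R <= 4 * (E * (4 * K + 7)) * #|S|%:R `^ a).
Proof.
move=> K0 E1 g0 a2 ga logE order S.
set A := E * (4 * K + 7); have A0 : 0 < A by rewrite mulr_gt0 //; lra.
have [n] := ubnP #|S|; elim: n S => // n IH S leSn.
have [->|S0] := eqVneq S set0.
  exists [::]; split=> [x y|v]; first by rewrite !inE.
  by rewrite mulr_ge0 ?powR_ge0 // mulr_ge0 // ltW.
have [t [ut tS sumt]] := order S S0.
set N := #|S| in sumt leSn *.
have N0 : (0 < N)%N by rewrite card_gt0.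
have Nr0 : 0 < N%:R :> R by rewrite ltr0n.
have N1 : 1 <= N%:R :> R by rewrite ler1n.
have Ng1 : 1 <= N%:R `^ g by rewrite ge1_powR.
pose avg := 2 * K * N%:R `^ g.
have avg0 : 0 < avg by rewrite !mulr_gt0 // (lt_le_trans ltr01).
pose k := Num.truncn avg.
pose bad := [set w in S | (k < cross (adj w) t)%N].
(* Markov's inequality *)
have bad_half : #|bad|%:R <= N%:R / 2 :> R.
  have : #|bad|%:R * avg <= (\sum_(w in S) cross (adj w) t)%:R.
    rewrite mulr_natl -sumr_const natr_sum /bad.
    rewrite [X in _ <= X](bigID (fun w => k < cross (adj w) t)%N) /=.
    under eq_bigl do rewrite inE.
    rewrite -[X in X <= _]addr0; apply: lerD; last exact: sumr_ge0.
    apply: ler_sum => w /andP[_]; rewrite truncn_lt_nat ?(ltW avg0) //; exact: ltW.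
  move=> /le_trans/(_ sumt); rewrite /avg => bnd.
  have KN : 0 < K * N%:R `^ g by rewrite mulr_gt0 // (lt_le_trans ltr01).
  by rewrite -(ler_pM2r KN); move: bnd; lra.
have badN : (#|bad| < N)%N.
  by rewrite -(ltr_nat R); apply: le_lt_trans bad_half _; lra.
have [L0 [A0L load0]] := IH bad (leq_trans badN leSn).
pose l := Num.truncn (4 * A * #|bad|%:R `^ a).
have l0 : 0 <= 4 * A * #|bad|%:R `^ a by rewrite mulr_ge0 ?powR_ge0 // mulr_ge0 // ltW.
have load0' v : (side_load L0 v <= l)%N by rewrite /l truncn_ge_nat.
pose h := (trunc_log 2 N).+1.
have Nh : (N <= 2 ^ h)%N by rewrite ltnW // trunc_log_ltn.
have [L [AL loadL]] := arcs_of_order ut tS Nh A0L load0'.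
exists L; split=> // v.
apply: le_trans (_ : (l + h * (2 * k + 7))%:R <= _).
  rewrite ler_nat; apply: leq_trans (loadL v) _; rewrite leq_add2l.
  have h0 : (0 < h)%N by [].
  by move: (h) (k) h0; clear; nia.
have lle : l%:R <= 3 * A * N%:R `^ a.
  apply: le_trans (_ : 4 * A * #|bad|%:R `^ a <= _); first by rewrite truncn_le.
  apply: le_trans (_ : 4 * A * (3 / 4 * N%:R `^ a) <= _); last by lra.
  rewrite ler_wpM2l //; first lra.
  apply: le_trans (half_powR a2 (ltW Nr0)).
  by rewrite ge0_ler_powR ?nnegrE //; lra.
have kle : k%:R <= avg by rewrite truncn_le ltW.
have hle : (h * (2 * k + 7))%:R <= A * N%:R `^ a.
  rewrite natrM natrD natrM -ga powRDp //.
  apply: le_trans (_ : (E * N%:R `^ e) * ((4 * K + 7) * N%:R `^ g) <= _).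
    apply: ler_pM; rewrite ?logE ?addr_ge0 ?mulr_ge0 //.
    by move: kle; rewrite /avg; lra.
  by rewrite /A; rewrite le_eqVlt; apply/orP; left; apply/eqP; ring.
by rewrite natrD; lra.
Qed.

(** The potential [K N m^g] pays for the insertions since its increments are
    of order [N m^(-b)]. *)
Lemma low_crossing_order (R : realType) (c d b e g E : R) (G : sgraph) (S : {set G}) :
  1 <= c -> 1 <= d -> 1 <= E -> 0 <= b -> b + e = 1 / d -> 0 < g -> g = 1 - b ->
  (forall n : nat, (0 < n)%N -> (trunc_log 2 n).+1%:R <= E * n%:R `^ e) ->
  (forall z : nat, (1 <= z <= #|G|)%N -> (graph_shatter G z)%:R <= c * z%:R `^ d) ->
  S != set0 ->
  exists t : seq G, [/\ uniq t, t =i S &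
    (\sum_(w in S) cross (adj w) t)%:R
      <= 32 * E * c / g * #|S|%:R * #|S|%:R `^ g].
Proof.
move=> c1 d1 E1 b0 be g0 gb logE shat S0.
set N := #|S|.
have EcN : 0 <= E * c * N%:R by rewrite !mulr_ge0 //; lra.
pose F m := 32 * E * c / g * N%:R * m%:R `^ g : R.
apply: (@order_by_insertion R G S F) => // [|U US U1].
  rewrite /F powR1 mulr1; have := divr_ge0 EcN (ltW g0); lra.
have [x [y [xU yU nxy sep]]] := close_pair c1 d1 E1 b0 be logE shat US U1.
exists x, y; split=> //; rewrite natrM /F -mulrBr.
have g1 : g <= 1 by lra.
have := powR_increment g0 g1 U1; have -> : g - 1 = - b by lra.
set D := _ - _ => inc.
apply: le_trans (_ : 2 * (8 * E * c * N%:R * #|U|%:R `^ (- b)) <= _).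
  by rewrite ler_wpM2l.
apply: le_trans (_ : 32 * E * c / g * N%:R * (g / 2 * #|U|%:R `^ (- b)) <= _).
  by rewrite le_eqVlt; apply/orP; left; apply/eqP; field; lra.
by rewrite ler_wpM2l //; have := divr_ge0 EcN (ltW g0); lra.
Qed.

Theorem mainTheorem9 (R : realType) (c d : R) (hc : 1 <= c) (hd : 1 <= d) :
  exists C : R, forall G : sgraph,
    (forall z : nat, (1 <= z <= #|G|)%N ->
       (graph_shatter G z)%:R <= c * z%:R `^ d) ->
    (lbp G)%:R <= C * #|G|%:R `^ (1 - 1 / (d + 1)).
Proof.
(* [e] is half of [1/d - 1/(d+1)], so [b] is the midpoint of [1/(d+1)] and
   [1/d]; the logarithms in [close_pair] and in [local_arcs] cost [e] each. *)
pose e : R := 1 / (2 * d * (d + 1)).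
pose b : R := 1 / (d + 1) + e.
pose g : R := 1 - b.
pose a : R := 1 - 1 / (d + 1).
have e0 : 0 < e by rewrite divr_gt0 // !mulr_gt0 //; lra.
have be : b + e = 1 / d by rewrite /b /e; field; apply/andP; split; lra.
have d1 : 0 < 1 / (d + 1) by rewrite divr_gt0 //; lra.
have a2 : 1 / 2 <= a.
  suff : 1 / (d + 1) <= 1 / 2 by rewrite /a; lra.
  by rewrite ler_pdivrMr; lra.
have b0 : 0 <= b by rewrite /b; lra.
have g0 : 0 < g.
  suff : 1 / d <= 1 by rewrite /g; lra.
  by rewrite ler_pdivrMr; lra.
have ga : g + e = a by rewrite /g /b /a; lra.
have [E E1 logE] := trunc_log_le_powR e0.
pose K := 32 * E * c / g.
have K0 : 0 < K by rewrite divr_gt0 // !mulr_gt0 //; lra.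
exists (4 * (E * (4 * K + 7))) => G shat.
have [|L [AL loadL]] := @local_arcs R K E a g e G K0 E1 (ltW g0) a2 ga logE _ setT.
  move=> S S0; exact: low_crossing_order hc hd E1 b0 be g0 _ logE shat S0.
rewrite cardsT in loadL; set B := _ * _ in loadL *.
have B0 : 0 <= B.
  by rewrite !mulr_ge0 ?powR_ge0 //; lra.
have : has_local_biclique_partition G (Num.truncn B).
  apply: (@local_partition_of_arcs _ L) => [x y|v]; first by rewrite AL !inE.
  by rewrite truncn_ge_nat.
rewrite /lbp; case: ex_minnP => l _ lmin /lmin.
by rewrite truncn_ge_nat.
Qed.
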